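(* Let $G$ be a graph and $B\subseteq V(G)$. Then $B$ is a skew zero forcing set for $G$ if and only if $B$ is a lazy burning set for the open neighborhood hypergraph $\mathcal{N}(G)$. In particular, $z_0(G)=b_L(\mathcal{N}(G))$.
   Context: Graphs are finite and simple. Skew zero forcing on $G$: an initial set of vertices is black, the rest white; repeatedly, any vertex $u$ (black or white) with exactly one white neighbor $w$ turns $w$ black. A skew zero forcing set is an initial black set from which all vertices eventually become black; $z_0(G)$ is the minimum size of one. The open neighborhood hypergraph $\mathcal{N}(G)$ has vertex set $V(G)$ and hyperedges $N_G(v)$ (open neighborhoods) for $v\in V(G)$. Lazy burning on a hypergraph $H$: a set $B\subseteq V(H)$ is burned initially; in each subsequent round every unburned vertex $v$ for which some hyperedge $h\ni v$ has $h\setminus\{v\}$ entirely burned becomes burned. $B$ is a lazy burning set if eventually all vertices burn; $b_L(H)$ is the minimum size of one. *)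

(* Defs.v *)
From HB Require Import structures.
From mathcomp Require Import all_boot.

Set Implicit Arguments.
Unset Strict Implicit.
Unset Printing Implicit Defensive.

Record sgraph := SGraph {
  vertex :> finType;
  adj : rel vertex;
  adj_sym : symmetric adj;
  adj_irrefl : irreflexive adj }.

Definition open_nbhd (G : sgraph) (v : G) : {set G} := [set w | adj v w].

(* Empty and singleton hyperedges are allowed: they occur in N(G) as the
   neighborhoods of isolated vertices and of leaves. *)
Record hypergraph := Hypergraph {
  hvertex :> finType;
  hyperedges : {set {set hvertex}} }.

Definition open_nbhd_hypergraph (G : sgraph) : hypergraph :=
  @Hypergraph (vertex G) [set open_nbhd v | v : G].

(* A single application of the skew color change rule; B and B' are the black
   sets before and after. The forcing vertex u may itself be white. *)
Definition skew_force (G : sgraph) : rel {set G} :=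
  [rel B B' | [exists u, exists w,
    (open_nbhd u :\: B == [set w]) && (B' == w |: B)]].

Definition skew_zero_forcing_set (G : sgraph) (B : {set G}) : bool :=
  connect (@skew_force G) B [set: G].

Definition burn_round (H : hypergraph) (B : {set H}) : {set H} :=
  B :|: [set v | (v \notin B) &&
    [exists h in hyperedges H, (v \in h) && (h :\ v \subset B)]].

(* Some iterate of burn_round sends B to the whole vertex set. *)
Definition lazy_burning_set (H : hypergraph) (B : {set H}) : bool :=
  fconnect (@burn_round H) B [set: H].

(* The whole vertex set is the candidate that arg min requires; see the two
   lemmas *_setT. *)
Definition skew_zero_forcing_number (G : sgraph) : nat :=
  #|[arg min_(B < [set: G] | skew_zero_forcing_set B) #|B|]|.

Definition lazy_burning_number (H : hypergraph) : nat :=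
  #|[arg min_(B < [set: H] | lazy_burning_set B) #|B|]|.

Lemma skew_zero_forcing_setT (G : sgraph) : skew_zero_forcing_set [set: G].
Proof. exact: connect0. Qed.

Lemma lazy_burning_setT (H : hypergraph) : lazy_burning_set [set: H].
Proof. exact: connect0. Qed.

Lemma skew_zero_forcing_numberP (G : sgraph) :
  (exists2 B : {set G}, skew_zero_forcing_set B &
     #|B| = skew_zero_forcing_number G) /\
  (forall B : {set G}, skew_zero_forcing_set B ->
     skew_zero_forcing_number G <= #|B|).
Proof.
rewrite /skew_zero_forcing_number; case: arg_minnP => [|B PB minB].
  exact: skew_zero_forcing_setT.
by split; first exists B.
Qed.

Lemma lazy_burning_numberP (H : hypergraph) :
  (exists2 B : {set H}, lazy_burning_set B & #|B| = lazy_burning_number H) /\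
  (forall B : {set H}, lazy_burning_set B -> lazy_burning_number H <= #|B|).
Proof.
rewrite /lazy_burning_number; case: arg_minnP => [|B PB minB].
  exact: lazy_burning_setT.
by split; first exists B.
Qed.

Lemma lazy_burning_setP (H : hypergraph) (B : {set H}) :
  reflect (exists k, iter k (@burn_round H) B = [set: H]) (lazy_burning_set B).
Proof.
rewrite /lazy_burning_set; apply: (iffP idP) => [conn|[k <-]]; last exact: fconnect_iter.
by exists (findex (@burn_round H) B [set: H]); apply: iter_findex.
Qed.

(* Main.v *)
Require Import Defs.
From mathcomp Require Import all_boot.

(** Burning [w] through the hyperedge [N(u)] is forcing [w] by [u].  A force is
    thus contained in one burning round, and rounds are monotone in the burned
    set; conversely the vertices burned in one round can be forced one at a
    time in any order, since a larger black set never blocks a force of a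
    vertex that is still white. *)

Lemma in_burn_round (H : hypergraph) (B : {set H}) (v : H) :
  (v \in burn_round B) =
  (v \in B) || [exists h in hyperedges H, (v \in h) && (h :\ v \subset B)].
Proof. by rewrite !inE; case: (v \in B). Qed.

Lemma burn_round_mono (H : hypergraph) :
  {homo @burn_round H : B C / B \subset C}.
Proof.
move=> B C sBC; apply/subsetP=> v; rewrite !in_burn_round.
case/orP=> [vB|/exists_inP[h hH /andP[vh sh]]]; first by rewrite (subsetP sBC).
by apply/orP; right; apply/exists_inP; exists h; rewrite // vh (subset_trans sh).
Qed.

Lemma iter_burn_round_mono (H : hypergraph) (k : nat) :
  {homo iter k (@burn_round H) : B C / B \subset C}.
Proof. by elim: k => // k IHk B C sBC; apply/burn_round_mono/IHk. Qed.

Lemma in_burn_round_open_nbhd (G : sgraph) (B : {set G}) (v : G) :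
  (v \in @burn_round (open_nbhd_hypergraph G) B) =
  (v \in B) ||
  [exists u, (v \in open_nbhd u) && (open_nbhd u :\ v \subset B)].
Proof.
apply: etrans (@in_burn_round (open_nbhd_hypergraph G) B v) _.
congr (_ || _); apply/exists_inP/existsP.
  by case=> _ /imsetP[u _ ->] uP; exists u.
by case=> u uP; exists (open_nbhd u); first exact: imset_f.
Qed.

Lemma skew_force_sub_burn_round (G : sgraph) (B C : {set G}) :
  skew_force B C -> C \subset @burn_round (open_nbhd_hypergraph G) B.
Proof.
case/existsP=> u /existsP[w /andP[/eqP Nu /eqP->]].
apply/subsetP=> v; rewrite in_burn_round_open_nbhd => /setU1P[->|->//].
apply/orP; right; apply/existsP; exists u.
have /setDP[-> _] : w \in open_nbhd u :\: B by rewrite Nu set11.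
(* Both [open_nbhd u :\ w \subset B] and [open_nbhd u :\: B \subset [set w]] say that [open_nbhd u]
   lies in [B] together with [w]. *)
by rewrite subDset setUC -subDset Nu subxx.
Qed.

(** One round is spent per force. Only inclusion can be kept, since a round may burn more than the
    one forced vertex; monotonicity carries the excess through the later rounds. *)
Lemma connect_skew_force_sub_iter (G : sgraph) (B C : {set G}) :
  connect (@skew_force G) B C ->
  exists k, C \subset iter k (@burn_round (open_nbhd_hypergraph G)) B.
Proof.
case/connectP=> p; elim: p B => [|B1 p IHp] B /=; first by move=> _ ->; exists 0.
case/andP=> /skew_force_sub_burn_round sB1 /IHp{}IHp /IHp[k sC].
exists k.+1; rewrite iterSr; apply: (subset_trans sC).
exact: (@iter_burn_round_mono (open_nbhd_hypergraph G)).
Qed.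

Lemma connect_skew_force_burn_round (G : sgraph) (B : {set G}) :
  connect (@skew_force G) B (@burn_round (open_nbhd_hypergraph G) B).
Proof.
set R := burn_round _.
(* Stated for every list of vertices of [R], so that induction can add one force at a time. *)
have force_seq (s : seq G) : {subset s <= R} ->
    connect (@skew_force G) B (B :|: [set x in s]).
  elim: s => [_|x s IHs sR]; first by rewrite set_nil setU0 connect0.
  have /IHs{IHs}/connect_trans : {subset s <= R}.
    by move=> y ys; rewrite sR // mem_behead.
  apply; rewrite set_cons setUCA.
  (* If [x] is already black, no force is made. *)
  set C := B :|: _; have [xC|xC] := boolP (x \in C).
    by rewrite (setUidPr _) ?sub1set ?connect0.
  apply: connect1; have := sR x (mem_head x s).
  have xB : x \notin B by apply: contra xC; rewrite inE => ->.
  rewrite in_burn_round_open_nbhd (negPf xB) /= => /existsP[u /andP[xu sB]].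
  apply/existsP; exists u; apply/existsP; exists x; rewrite eqxx andbT.
  (* The [u] whose neighborhood burns [x] from [B] still forces [x] from [C]: its other neighbors
     lie in [B], hence in [C], and [x] is white. *)
  rewrite eqEsubset sub1set in_setD xC xu subDset setUC -subDset !andbT.
  exact: subset_trans sB (subsetUl _ _).
have -> : R = B :|: [set x in enum R].
  rewrite set_enum; apply/esym/setUidPr/subsetP=> v vB.
  by rewrite in_burn_round_open_nbhd vB.
by apply: force_seq => x; rewrite mem_enum.
Qed.

Lemma skew_zero_forcing_lazy_burning (G : sgraph) (B : {set G}) :
  skew_zero_forcing_set B = @lazy_burning_set (open_nbhd_hypergraph G) B.
Proof.
apply/idP/lazy_burning_setP => [/connect_skew_force_sub_iter[k]|[k kT]].
  by rewrite subTset => /eqP kT; exists k.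
rewrite /skew_zero_forcing_set -kT; elim: k {kT} => [|k IHk]; first exact: connect0.
exact: connect_trans IHk (connect_skew_force_burn_round _ _).
Qed.

Theorem theorem4p3 (G : sgraph) :
  (forall B : {set G},
     skew_zero_forcing_set B <->
     @lazy_burning_set (open_nbhd_hypergraph G) B) /\
  skew_zero_forcing_number G = lazy_burning_number (open_nbhd_hypergraph G).
Proof.
split=> [B|]; first by rewrite skew_zero_forcing_lazy_burning.
have [[B zB cB] minz] := skew_zero_forcing_numberP G.
have [[C bC cC] minb] := lazy_burning_numberP (open_nbhd_hypergraph G).
(* Each number is bounded by the size of a minimizer for the other: [C] is skew zero forcing and [B]
   is lazy burning. *)
apply/eqP; rewrite eqn_leq -{1}cC -{2}cB minz ?minb //.
  by rewrite -skew_zero_forcing_lazy_burning.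
by rewrite skew_zero_forcing_lazy_burning.
Qed.
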